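(* Let $P$ be the Gaussian parity on Gauss diagrams on $\mathbb{R}$ and let $m\in\mathbb{N}\cup\{\infty\}$. Let $(K_{\oplus,\oplus},K_{\oplus,\ominus},K_{\ominus,\oplus},K_{\ominus,\ominus},K_{00})$ be a virtual Conway quintuple such that the two affected crossings are linked and both have $f^\infty$-label $\infty$, and such that the smoothing does not change the $f^{\infty}$-labels of the remaining crossings. Then $$\nabla[m](K_{\oplus,\oplus})-\nabla[m](K_{\oplus,\ominus})-\nabla[m](K_{\ominus,\oplus})+\nabla[m](K_{\ominus,\ominus})=z^2\,\nabla[m](K_{00}).$$
   Context: Gauss diagrams. A Gauss diagram (on $\mathbb{R}$) is the oriented line with finitely many arrows, each with a sign $\oplus=+1$ or $\ominus=-1$, all endpoints distinct, up to orientation-preserving homeomorphism. $C(D)$ is the set of arrows (crossings) of $D$. Two arrows are linked if their endpoints alternate. Long virtual knots are equivalence classes of Gauss diagrams on $\mathbb{R}$ under the usual Reidemeister moves for Gauss diagrams; $D_K$ is any Gauss diagram of $K$. Quintuples. Two linked arrows $x,y$ of a diagram are fixed. $K_{\varepsilon_1,\varepsilon_2}$ ($\varepsilon_i\in\{\oplus,\ominus\}$) are four diagrams which differ only by crossing changes at $x,y$ (a crossing change reverses both the sign and the direction of the arrow), $x$ having sign $\varepsilon_1$ and $y$ sign $\varepsilon_2$. $K_{00}$ is obtained by the oriented smoothing at both $x$ and $y$: if the endpoints are $p_1<p_2<p_3<p_4$, with $x$ joining $p_1,p_3$ and $y$ joining $p_2,p_4$, cutting the line into successive segments $s_0,s_1,s_2,s_3,s_4$,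 then the Gauss diagram of $K_{00}$ is obtained by deleting $x,y$ and reassembling the line as $s_0s_3s_2s_1s_4$ with orientations of segments kept, all other arrows retaining their endpoints, directions and signs. Labels. Gaussian parity: an arrow is odd (even) if it is linked with an odd (even) number of arrows. $f(D)$ deletes all odd arrows of $D$. With $\infty+1=\infty$, the $f^m$-label of $x\in C(D)$ is the least $i$, $1\le i\le m$, with $x\notin C(f^i(D))$, and $m+1$ if there is none. $\Lambda[m](D)$ is $D$ with its $f^m$-labelling; $I[m](D)=\sum_{F\subseteq D}F$ over all subdiagrams (subsets of arrows, keeping signs and labels). $\langle F,E\rangle$ is the bilinear pairing with $\langle D,E\rangle=\delta_{DE}$ on labelled diagrams. Conway formulas. Smoothing all arrows of a Gauss diagram on $\mathbb{R}$: a traveller arriving at an endpoint of an arrow (moving along the orientation of the line) jumps to the other endpoint of that arrow and continues from there along the orientation. The diagram has one component if the result is a single path from $-\infty$ to $\infty$ (no closed components); then each arrow is passed exactly twice. A one-component diagram is ascending if the first pass along each arrow is from its tail to its head. $C_{2n}$ is the sum of all ascending (one-component) signed Gauss diagrams with exactly $2n$ arrows, each weighted by the product of the signs of its arrows. $C^e_{2n}[m]$ is $C_{2n}$ with every arrow labelled $m+1$ ($\infty$ if $m=\infty$). $C^o_{2n}[m]$ is the sum of the diagrams obtained from summands of $C_{2n}$ (with the same weights) by labelling arrows by elements of $\{1,\dots,m+1\}$ in all possible ways such that not all labels equal $m+1$; $C^o_{2n}[\infty]=0$ and $C^o_0[m]=0$. Define $$c_{2n}[m](K)=\langle C^e_{2n}[\infty],I[\infty]\circ\Lambda[\infty](D_K)\rangle+\langle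 C^o_{2n}[m],I[m]\circ\Lambda[m](D_K)\rangle,\qquad \nabla[m](K)=\sum_{n\ge0}c_{2n}[m](K)z^{2n}.$$ These are invariants of long virtual knots. *)

(* Defs.v *)
From HB Require Import structures.
From mathcomp Require Import all_boot all_order all_algebra.
From mathcomp.multinomials Require Import freeg.
From Stdlib Require Import ClassicalEpsilon.

Set Implicit Arguments.
Unset Strict Implicit.
Unset Printing Implicit Defensive.

Import GRing.Theory Num.Theory.
Local Open Scope ring_scope.

Section GaussCodes.

Variable A : finType.

(* An arrow endpoint is a pair (a, b): the tail of the arrow a if b = true, its
   head if b = false.  A Gauss diagram is recorded by the sequence of endpoints
   met along the oriented line, and the signs of the arrows (true for +1, false
   for -1).  A is a set of names for arrows: the actual arrows of the diagram
   are those occurring in the word, so that a diagram, its subdiagrams, its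
   crossing changes and its smoothings can share the same names. *)
Record gauss_code := GaussCode {
  word : seq (A * bool);
  sgn : {ffun A -> bool}
}.

Definition opp_end (e : A * bool) : A * bool := (e.1, ~~ e.2).

Definition gauss_diagram (D : gauss_code) : bool :=
  uniq (word D) && all (fun e => opp_end e \in word D) (word D).

Definition crossings (D : gauss_code) : {set A} :=
  [set a | a \in [seq e.1 | e <- word D]].

Definition linked (D : gauss_code) (a b : A) : bool :=
  (a != b) && ([seq e.1 | e <- word D & e.1 \in [:: a; b]]
    \in [:: [:: a; b; a; b]; [:: b; a; b; a]]).

Definition subdiagram (D : gauss_code) (S : {set A}) : gauss_code :=
  GaussCode [seq e <- word D | e.1 \in S] (sgn D).

Definition crossing_change (a : A) (D : gauss_code) : gauss_code :=
  GaussCode [seq (e.1, (e.1 == a) (+) e.2) | e <- word D]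
            [ffun b => (b == a) (+) sgn D b].

(* D0 is obtained from D by the oriented smoothing at both of the linked arrows
   x and y, whichever comes first on the line. *)
Definition double_smoothing (x y : A) (D D0 : gauss_code) : Prop :=
  exists s0 s1 s2 s3 s4 : seq (A * bool), exists e1 e2 e3 e4 : A * bool,
  [/\ word D = s0 ++ e1 :: s1 ++ e2 :: s2 ++ e3 :: s3 ++ e4 :: s4,
      [:: e1.1; e2.1; e3.1; e4.1] \in [:: [:: x; y; x; y]; [:: y; x; y; x]],
      word D0 = s0 ++ s3 ++ s2 ++ s1 ++ s4
    & {in crossings D0, sgn D0 =1 sgn D}].

(* In the names of the diagrams, p and m are the signs of x and y, in this
   order.  Crossing changes do not affect linking, so that the linking
   hypothesis on Kpp holds in all four diagrams. *)
Record conway_quintuple (x y : A) (Kpp Kpm Kmp Kmm K00 : gauss_code) : Prop := {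
  quintuple_diagram : gauss_diagram Kpp;
  quintuple_linked : linked Kpp x y;
  quintuple_sgn_x : sgn Kpp x = true;
  quintuple_sgn_y : sgn Kpp y = true;
  quintuple_pm : Kpm = crossing_change y Kpp;
  quintuple_mp : Kmp = crossing_change x Kpp;
  quintuple_mm : Kmm = crossing_change x (crossing_change y Kpp);
  quintuple_00 : double_smoothing x y Kpp K00
}.

Definition odd_arrow (D : gauss_code) (a : A) : bool :=
  odd #|[set b in crossings D | linked D a b]|.

Definition parity_map (D : gauss_code) : gauss_code :=
  subdiagram D [set a | ~~ odd_arrow D a].

End GaussCodes.

(* Elements of {0, 1, ...} together with infinity, which is None. *)
Definition natinf := option nat.

Definition natinf_succ (m : natinf) : natinf := omap succn m.

Definition leq_natinf (i : nat) (m : natinf) : bool :=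
  if m is Some k then (i <= k)%N else true.

Section Labels.

Variable A : finType.

Definition removed_at (m : natinf) (D : gauss_code A) (x : A) (i : nat) : bool :=
  [&& 0 < i, leq_natinf i m & x \notin crossings (iter i (@parity_map A) D)]%N.

Definition flabel (m : natinf) (D : gauss_code A) (x : A) : natinf :=
  match excluded_middle_informative (exists i, removed_at m D x i) with
  | left ex => Some (ex_minn ex)
  | right _ => natinf_succ m
  end.

Definition labelled_gauss_code := (gauss_code A * (A -> natinf))%type.

Definition Lambda (m : natinf) (D : gauss_code A) : labelled_gauss_code :=
  (D, flabel m D).

End Labels.

(* A labelled Gauss diagram up to renaming of its arrows: each endpoint is
   recorded as (position of the other endpoint of its arrow, is it a tail?, sign
   of the arrow, label of the arrow).  See diagram_eqP. *)
Definition labelled_diagram : choiceType := seq (nat * bool * bool * natinf).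

Definition diagram (A : finType) (L : labelled_gauss_code A) : labelled_diagram :=
  [seq (index (opp_end e) (word L.1), e.2, sgn L.1 e.1, L.2 e.1)
     | e <- word L.1].

Definition formal_sum := {freeg labelled_diagram / int}.

Definition pairing (F E : formal_sum) : int :=
  \sum_(X <- dom F) coeff X F * coeff X E.

Definition I_map (A : finType) (L : labelled_gauss_code A) : formal_sum :=
  \sum_(S : {set A} | S \subset crossings L.1)
    << 1 *g diagram (subdiagram L.1 S, L.2) >>.

Section Ascending.

Variable A : finType.

(* The endpoints at which a traveller arrives when starting just before position
   i of the word w, during at most n steps. *)
Fixpoint travel (w : seq (A * bool)) (n i : nat) : seq (A * bool) :=
  if n is n'.+1 then
    if onth w i is Some e then e :: travel w n' (index (opp_end e) w).+1
    else [::]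
  else [::].

(* The traveller coming from -oo arrives at most once at each endpoint, so that
   size (word D) steps suffice to reach +oo. *)
Definition journey (D : gauss_code A) : seq (A * bool) :=
  travel (word D) (size (word D)) 0.

(* A closed component would contain some endpoint, and the traveller coming
   from -oo would never arrive at it. *)
Definition one_component (D : gauss_code A) : bool :=
  all (fun e => e \in journey D) (word D).

Definition ascending (D : gauss_code A) : bool :=
  one_component D &&
  [forall a in crossings D,
     index (a, true) (journey D) < index (a, false) (journey D)]%N.

Definition signz (b : bool) : int := if b then 1 else -1.

Definition weight (D : gauss_code A) : int :=
  \prod_(a in crossings D) signz (sgn D a).

End Ascending.

(* All Gauss diagrams with exactly k arrows, each listed once: among the k!
   numberings of its arrows by 0, ..., k-1, we take the one where the last
   endpoints of the arrows 0, ..., k-1 come in this order (undup keeps the last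
   occurrences).  See uniq_all_diagrams and mem_all_diagrams. *)
Definition all_diagrams (k : nat) : seq (gauss_code 'I_k) :=
  [seq GaussCode w s |
     w <- [seq w <- permutations (enum {: 'I_k * bool})
             | undup [seq e.1 | e <- w] == enum 'I_k],
     s <- enum {ffun 'I_k -> bool}].

Definition C_even (n : nat) (m : natinf) : formal_sum :=
  \sum_(D <- all_diagrams n.*2 | ascending D)
    << weight D *g diagram (D, fun=> natinf_succ m) >>.

(* A labelling by {1, ..., k + 1} is given by l : {ffun _ -> 'I_k.+1}, the label
   of a being l a + 1. *)
Definition C_odd (n : nat) (m : natinf) : formal_sum :=
  if m is Some k then
    \sum_(D <- all_diagrams n.*2 | ascending D)
      \sum_(l : {ffun 'I_n.*2 -> 'I_k.+1} | [exists a, (l a).+1 != k.+1])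
        << weight D *g diagram (D, fun a => Some (l a).+1) >>
  else 0.

Definition conway_coef (A : finType) (n : nat) (m : natinf)
    (D : gauss_code A) : int :=
  pairing (C_even n None) (I_map (Lambda None D))
  + pairing (C_odd n m) (I_map (Lambda m D)).

(* The sum over all n is finite: the terms left out vanish, as shown by
   coef_nabla below. *)
Definition nabla (A : finType) (m : natinf) (D : gauss_code A) : {poly int} :=
  \sum_(n < (size (word D)).+1) conway_coef n m D *: 'X^(n.*2).

Lemma diagram_eqP (A B : finType) (b0 : B)
    (L : labelled_gauss_code A) (M : labelled_gauss_code B) :
  gauss_diagram L.1 -> gauss_diagram M.1 ->
  diagram L = diagram M <->
  exists phi : A -> B,
    [/\ {in crossings L.1 &, injective phi},
        word M.1 = [seq (phi e.1, e.2) | e <- word L.1],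
        {in crossings L.1, forall a, sgn M.1 (phi a) = sgn L.1 a}
      & {in crossings L.1, forall a, M.2 (phi a) = L.2 a}].
Proof.
case: L M => [[w s] l] [[v t] m] /= /andP[/= uw /allP/= ow] /andP[/= uv /allP/= ov].
have memc (a : A) : (a \in crossings (GaussCode w s)) = (a \in map fst w).
  by rewrite inE.
split=> [eqd | [phi [injphi /= -> sE mE]]]; last first.
  rewrite /diagram /= -map_comp; apply/eq_in_map => e ew /=.
  have ce c : c \in w -> c.1 \in crossings (GaussCode w s).
    by move=> cw; rewrite memc map_f.
  rewrite sE ?mE ?ce //; congr (_, _, _, _).
  have inj : {in w &, injective (fun c : A * bool => (phi c.1, c.2))}.
    by move=> [a b] [a' b'] cw cw' /= [/(injphi _ _ (ce _ cw) (ce _ cw')) /= -> ->].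
  rewrite /opp_end /=.
  have /= := ow _ ew; rewrite /opp_end; set c := (e.1, ~~ e.2) => cw.
  have -> : (phi e.1, ~~ e.2) = (fun c : A * bool => (phi c.1, c.2)) c by [].
  elim: (w) inj cw => //= d u IH inj; rewrite inE => cu.
  have [-> | ndc] := eqVneq d c; first by rewrite eqxx.
  have {}cu : c \in u by move: cu; rewrite eq_sym (negPf ndc).
  case: eqP => [dE | _].
    by case/eqP: ndc; exact: inj (mem_head _ _) (mem_behead (s := d :: u) cu) dE.
  by rewrite IH //; apply: sub_in2 inj => z zu; rewrite inE zu orbT.
have szw : size v = size w by have := congr1 size eqd; rewrite /diagram !size_map.
case: (w =P [::]) => [w0|/eqP w_neq0].
  have v0 : v = [::] by apply/size0nil; rewrite szw w0.
  exists (fun=> b0); split=> [a a' | | a | a]; rewrite ?memc ?w0 ?v0 //.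
pose e0 : B * bool := (b0, true).
pose phi a := (nth e0 v (index (a, true) w)).1.
have key c : c \in w ->
  [/\ index (opp_end c) w = index (opp_end (nth e0 v (index c w))) v,
     (nth e0 v (index c w)).2 = c.2,
     t (nth e0 v (index c w)).1 = s c.1 & m (nth e0 v (index c w)).1 = l c.1].
  move=> cw; have iw : (index c w < size w)%N by rewrite index_mem.
  have := congr1 (fun z => nth (0%N, true, true, None) z (index c w)) eqd.
  rewrite /diagram (nth_map c) // (nth_map e0) ?szw // nth_index //=.
  by case=> -> -> -> ->.
have nthv c : c \in w -> nth e0 v (index c w) = (phi c.1, c.2).
  move=> cw; have [iE bE _ _] := key _ cw.
  have iv : (index c w < size v)%N by rewrite szw index_mem.
  case: c cw iE bE iv => a [] cw iE bE iv; first by rewrite /phi -bE -surjective_pairing.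
  rewrite /phi -[(a, true)]/(opp_end (a, false)) iE.
  rewrite nth_index ?ov ?mem_nth //.
  by rewrite [LHS]surjective_pairing bE.
have tw a : a \in crossings (GaussCode w s) -> (a, true) \in w.
  rewrite memc => /mapP[[a' []] cw /= ->] //.
  by have := ow _ cw.
exists phi; split=> [a a' /tw aw /tw a'w eqphi | | a /tw aw | a /tw aw].
- have := nthv _ aw; rewrite /= eqphi -[RHS](nthv _ a'w) => /eqP.
  rewrite nth_uniq ?szw ?index_mem // => /eqP iE.
  by have := nth_index (a, true) aw; rewrite iE nth_index // => -[].
- apply: (@eq_from_nth _ e0); first by rewrite size_map.
  move=> i; rewrite szw => iw.
  have [a0 _] : exists c : A * bool, c \in w.
    by case: (w) w_neq0 => // c u _; exists c; rewrite mem_head.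
  rewrite (nth_map a0) // -nthv ?mem_nth // index_uniq //.
- by have [_ _ + _] := key _ aw; rewrite nthv.
- by have [_ _ _ +] := key _ aw; rewrite nthv.
Qed.

Lemma undup_map_in (T U : eqType) (g : T -> U) (s : seq T) :
  {in s &, injective g} -> undup (map g s) = map g (undup s).
Proof.
elim: s => //= a s IH injg.
have gE : (g a \in map g s) = (a \in s).
  apply/mapP/idP => [[b bs /injg ->] //|as_]; last by exists a.
    exact: mem_head.
  by rewrite inE bs orbT.
have {}IH : undup (map g s) = map g (undup s).
  by apply: IH; apply: sub_in2 injg => z zs; rewrite inE zs orbT.
by rewrite gE; case: ifP => //= _; rewrite IH.
Qed.

Lemma all_diagrams_gauss (k : nat) (w : seq ('I_k * bool)) s :
  w \in permutations (enum {: 'I_k * bool}) ->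
  gauss_diagram (GaussCode w s) /\ crossings (GaussCode w s) = setT.
Proof.
rewrite mem_permutations => pw; have wT c : c \in w.
  by rewrite (perm_mem pw) mem_enum.
split; first rewrite /gauss_diagram /= (perm_uniq pw) enum_uniq /=.
  by apply/allP => c _; exact: wT.
by apply/setP => a; rewrite !inE; apply/mapP; exists (a, true).
Qed.

Lemma uniq_all_diagrams (k : nat) :
  uniq [seq diagram (D, fun=> None) | D <- all_diagrams k].
Proof.
rewrite /all_diagrams map_allpairs; apply: allpairs_uniq.
- exact/filter_uniq/permutations_uniq.
- exact: enum_uniq.
move=> p q /allpairsP[[w s] [/= + _ ->]] /allpairsP[[v t] [/= + _ ->]] /=.
rewrite !mem_filter => /andP[/eqP sw pw] /andP[/eqP sv pv].
have [gw cw] := all_diagrams_gauss s pw; have [gv cv] := all_diagrams_gauss t pv.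
have [i _ | k0] := pickP [pred i : 'I_k | true]; last first.
  move=> _; have nil (u : seq ('I_k * bool)) : u = [::].
    by case: u => // -[a ?] ?; have := k0 a.
  rewrite (nil w) (nil v); congr (_, _); apply/ffunP => a; by have := k0 a.
move=> /(diagram_eqP (L := (GaussCode w s, _)) (M := (GaussCode v t, _)) i gw gv).
rewrite /= cw => -[phi [injphi vE tE _]].
have phi1 : phi =1 id.
  have : map phi (enum 'I_k) = map id (enum 'I_k).
    rewrite map_id -[RHS]sv vE -map_comp -[in LHS]sw -undup_map_in.
      by rewrite -map_comp.
    by apply: sub_in2 injphi => a _; rewrite inE.
  by move/eq_in_map => + a; apply; rewrite mem_enum.
congr (_, _).
  rewrite vE -[LHS]map_id; apply: eq_map => c /=.
  by rewrite phi1 -surjective_pairing.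
by apply/ffunP => a; rewrite -tE ?inE // phi1.
Qed.

Lemma mem_all_diagrams (A : finType) (D : gauss_code A) :
  gauss_diagram D ->
  diagram (D, fun=> None) \in
    [seq diagram (E, fun=> None) | E <- all_diagrams #|crossings D|].
Proof.
case: D => w s gD; rewrite /all_diagrams map_allpairs.
set D := GaussCode w s in gD *; pose o := undup (map fst w).
have mo a : (a \in o) = (a \in crossings D) by rewrite mem_undup inE.
have szo : size o = #|crossings D|.
  by rewrite -(card_uniqP (undup_uniq _)); apply: eq_card => a; rewrite -mo.
have endsw a b : a \in o -> (a, b) \in w.
  rewrite mem_undup => /mapP[[a' b'] cw /= ->].
  case/andP: gD => _ /allP /(_ _ cw) /=; rewrite /opp_end /=.
  by move: cw; case: b b' => -[].
case k_eq : #|crossings D| szo => [|k] szo.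
  apply/allpairsP; exists ([::], [ffun i => true]); split=> /=.
  - rewrite mem_filter mem_permutations /=; apply/andP; split.
      by rewrite eq_sym -size_eq0 -cardE card_ord.
    rewrite perm_sym; apply/perm_nilP/size0nil.
    by rewrite -cardE card_prod card_ord.
  - by rewrite mem_enum.
  suff w0 : w = [::] by rewrite /D w0.
  case Ew: w => [|c u] //; have : c.1 \in o.
    by rewrite mem_undup map_f // Ew mem_head.
  by rewrite (size0nil szo).
have a0 : A.
  by case: (o) szo => // a.
pose phi a : 'I_k.+1 := inord (index a o).
have injphi : {in o &, injective phi}.
  move=> a a' ao a'o /(congr1 (@nat_of_ord _)); rewrite !inordK -?szo ?index_mem // => eqi.
  by rewrite -(nth_index a0 ao) eqi nth_index.
have wo c : c \in w -> c.1 \in o by move=> cw; rewrite mem_undup map_f.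
pose w' := [seq (phi c.1, c.2) | c <- w].
pose s' := [ffun i : 'I_k.+1 => s (nth a0 o i)].
have injw : {in w &, injective (fun c : A * bool => (phi c.1, c.2))}.
  by move=> [a b] [a' b'] cw cw' [/(injphi _ _ (wo _ cw) (wo _ cw')) /= -> ->].
have pw' : w' \in permutations (enum {: 'I_k.+1 * bool}).
  rewrite mem_permutations; apply: uniq_perm; last first.
  - move=> [i b]; rewrite mem_enum inE; apply/mapP.
    have io : (i < size o)%N by rewrite szo.
    exists (nth a0 o i, b); first by rewrite endsw // mem_nth.
    by rewrite /phi /= index_uniq ?undup_uniq // inord_val.
  - exact: enum_uniq.
  by rewrite map_inj_in_uniq //; case/andP: gD.
have [gD' _] := all_diagrams_gauss s' pw'.
apply/allpairsP; exists (w', s'); split=> /=; last first.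
- apply/(diagram_eqP (L := (D, _)) (M := (GaussCode w' s', _)) (@ord0 k)) => //=.
  exists phi; split=> // [a a' | a]; rewrite -!mo => ao; first by move=> ?; exact: injphi.
  by rewrite ffunE inordK ?nth_index // -szo index_mem.
- by rewrite mem_enum.
rewrite mem_filter pw' andbT; apply/eqP.
rewrite -map_comp (eq_map (g := phi \o fst)) // map_comp undup_map_in; last first.
  by apply: sub_in2 injphi => a; rewrite mem_undup.
apply: (@eq_from_nth _ ord0); first by rewrite size_map size_enum_ord szo.
move=> i; rewrite size_map => io; rewrite (nth_map a0) //.
apply/ord_inj; rewrite nth_enum_ord -?szo //.
by rewrite /= inordK index_uniq ?undup_uniq // -szo.
Qed.

Lemma pairingE (F E : formal_sum) :
  pairing F E = fglift (fun X => coeff X E : int^o) F.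
Proof.
rewrite -[in RHS](Freeg_dom F) fglift_Freeg /prelift big_map.
by apply: eq_bigr.
Qed.

Lemma pairingU (a b : int) (X Y : labelled_diagram) :
  pairing << a *g X >> << b *g Y >> = a * b * (X == Y)%:R.
Proof. by rewrite pairingE liftU /= coeffU eq_sym -[LHS]/(a * _) mulrA. Qed.

Lemma pairingBl (E : formal_sum) : {morph pairing^~ E : F G / F - G}.
Proof. by move=> F G; rewrite !pairingE; exact: (@lift_is_additive int _ int^o). Qed.

Lemma pairingBr (F : formal_sum) : {morph pairing F : E G / E - G}.
Proof.
move=> E G; rewrite /pairing -sumrB; apply: eq_bigr => X _.
by rewrite coeffB mulrBr.
Qed.

Lemma pairing0l E : pairing 0 E = 0.
Proof. by rewrite -(subrr 0) pairingBl subrr. Qed.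

Lemma pairing0r F : pairing F 0 = 0.
Proof. by rewrite -(subrr 0) pairingBr subrr. Qed.

Lemma pairingDl (E : formal_sum) : {morph pairing^~ E : F G / F + G}.
Proof.
move=> F G; rewrite -[G in LHS]opprK pairingBl -[- G]add0r pairingBl.
by rewrite pairing0l sub0r opprK.
Qed.

Lemma pairingDr (F : formal_sum) : {morph pairing F : E G / E + G}.
Proof.
move=> E G; rewrite -[G in LHS]opprK pairingBr -[- G]add0r pairingBr.
by rewrite pairing0r sub0r opprK.
Qed.

Lemma size_diagram (A : finType) (L : labelled_gauss_code A) :
  size (diagram L) = size (word L.1).
Proof. by rewrite size_map. Qed.

Lemma sum_all_diagrams0 (V : nmodType) (k : nat) (P : pred (gauss_code 'I_k))
    (F : gauss_code 'I_k -> V) :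
  (forall D, size (word D) = k.*2 -> F D = 0) ->
  \sum_(D <- all_diagrams k | P D) F D = 0.
Proof.
move=> F0; rewrite big_mkcond big_allpairs_dep /= big_seq big1 // => w.
rewrite mem_filter mem_permutations => /andP[_ /perm_size].
rewrite -cardE card_prod card_ord card_bool muln2 => szw.
by rewrite big1 // => s _; rewrite F0 // if_same.
Qed.

Lemma pairing_I_map0 (A : finType) (L : labelled_gauss_code A) (a : int)
    (X : labelled_diagram) :
  (size (word L.1) < size X)%N -> pairing << a *g X >> (I_map L) = 0.
Proof.
move=> szX; rewrite /I_map (big_morph _ (pairingDr _) (pairing0r _)) big1 // => S _.
rewrite pairingU; case: eqP => [XE|_]; last by rewrite mulr0.
move: szX; rewrite XE size_diagram size_filter ltnNge.
by rewrite count_size.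
Qed.

Lemma conway_coef0 (A : finType) (n : nat) (m : natinf) (D : gauss_code A) :
  (size (word D) < n)%N -> conway_coef n m D = 0.
Proof.
move=> szD; have szE (E : gauss_code 'I_n.*2) l k : size (word E) = n.*2.*2 ->
    (size (word (Lambda k D).1) < size (diagram (E, l)))%N.
  move=> szE; rewrite size_diagram /= szE (leq_trans szD) // -!addnn -addnA.
  exact: leq_addr.
rewrite /conway_coef /C_even /C_odd.
rewrite (big_morph _ (pairingDl _) (pairing0l _)) sum_all_diagrams0 ?add0r; last first.
  by move=> E /szE sz; exact: pairing_I_map0.
case: m => [k|]; last exact: pairing0l.
rewrite (big_morph _ (pairingDl _) (pairing0l _)) sum_all_diagrams0 // => E /szE sz.
rewrite (big_morph _ (pairingDl _) (pairing0l _)) big1 // => l _.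
exact: pairing_I_map0.
Qed.

Lemma coef_nabla (A : finType) (m : natinf) (D : gauss_code A) (i : nat) :
  (nabla m D)`_i = if odd i then 0 else conway_coef i./2 m D.
Proof.
rewrite /nabla coef_sum.
under eq_bigr => n _ do rewrite coefZ coefXn.
case: ifPn => [oi | /negPf ei].
  rewrite big1 // => n _; case: eqP => [iE|_]; last exact: mulr0.
  by rewrite iE odd_double in oi.
have iE : i = i./2.*2 by rewrite -[LHS]odd_double_half ei.
have [lt_i | ge_i] := ltnP i./2 (size (word D)).+1.
  rewrite (bigD1 (Ordinal lt_i)) //= -iE eqxx mulr1 big1 ?addr0 // => n.
  rewrite -val_eqE /= => /negPf ni; case: eqP => [eqi|_]; last exact: mulr0.
  by rewrite eqi doubleK eqxx in ni.
rewrite conway_coef0 // big1 // => n _; case: eqP => [eqi|_]; last exact: mulr0.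
by move: ge_i; rewrite eqi doubleK leqNgt ltn_ord.
Qed.

(* Main.v *)
From HB Require Import structures.
Require Import Defs.
From mathcomp Require Import all_boot all_order all_algebra zify.
From mathcomp.multinomials Require Import freeg.
From Stdlib Require Import ClassicalEpsilon.

Set Implicit Arguments.
Unset Strict Implicit.
Unset Printing Implicit Defensive.

Import GRing.Theory.
Local Open Scope ring_scope.

(** The two pairings which define a Conway coefficient can be evaluated: each
    subdiagram with 2n arrows matches exactly one diagram of the list of all
    diagrams, so that the coefficient of degree 2n is the sum of the weights of
    the ascending subdiagrams with 2n arrows whose labels are acceptable
    ([conway_coefE]).  Acceptable means that all labels for f^infinity are
    infinite, or, when m is finite, that some of them is at most m.

    Crossing changes affect neither linking nor labels, so the four diagrams
    of the quintuple have the same acceptable sets S of arrows, and their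
    contributions can be compared set by set ([alternating_sum]).  If S misses
    x or y, the four contributions cancel in pairs.  If S contains x and y, the
    path through the smoothed subdiagram is the same in all four cases; only
    the directions of x and y change, and when there is one component, exactly
    one of the four choices makes both x and y ascend.  The sign with which it
    enters the alternating sum cancels the signs of x and y in its weight.  What
    is left is the sum, over the sets S containing x and y, of the weights of
    the arrows other than x and y, when the subdiagram has one component and
    these other arrows ascend.

    Smoothing all the arrows of S amounts to smoothing x and y, then the others.
    So the traveller meets the remaining endpoints in the same order in K00,
    restricted to S without x and y, as in the original diagram restricted to S
    ([journey_smoothing]); the number of components being one
    ([one_component_smoothing]) and the ascending condition
    ([ordered_smoothing]) are thus the same on both sides.  As x and y have label
    infinity and the other labels are preserved, S is acceptable if and only if
    S without x and y is.  Two arrows have been lost, whence the factor z^2. *)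

(** * Routes through the smoothed diagram *)

Section Route.

Variable A : finType.
Implicit Types (D : gauss_code A) (e : A * bool) (w u j : seq (A * bool)).

Lemma opp_endK : involutive (@opp_end A).
Proof. by case=> a b; rewrite /opp_end negbK. Qed.

Definition after e w := drop (index e w).+1 w.

(** [route w u j] says that [j] lists the endpoints where a traveller arrives
    who has the suffix [u] of [w] ahead and eventually reaches the end of [w].
    As it has neither positions nor a bound on the number of steps, unlike
    [travel], it allows induction on the journey itself. *)
Inductive route w : seq (A * bool) -> seq (A * bool) -> Prop :=
| route_nil : route w [::] [::]
| route_cons e u j :
    route w (after (opp_end e) w) j -> route w (e :: u) (e :: j).

Lemma route_functional w u j j' : route w u j -> route w u j' -> j = j'.
Proof.
move=> r; elim: r j' => [|e v k _ IH] j' r'; first by inversion r'.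
by inversion r'; subst; congr cons; exact: IH.
Qed.

Lemma gauss_uniq D : gauss_diagram D -> uniq (word D).
Proof. by case/andP. Qed.

Lemma opp_in_word D e : gauss_diagram D -> (opp_end e \in word D) = (e \in word D).
Proof.
case/andP=> _ /allP opw; apply/idP/idP => [/opw|/opw //].
by rewrite opp_endK.
Qed.

Lemma end_in_word D a b :
  gauss_diagram D -> ((a, b) \in word D) = (a \in crossings D).
Proof.
move=> gD; rewrite inE; apply/idP/mapP => [|[[a' b'] ew /= ->]]; first by exists (a, b).
case: (altP (b =P b')) => [-> // | /negPf nb].
by rewrite -opp_in_word // /opp_end /=; case: b b' nb ew => -[].
Qed.

(** The traveller never runs into a loop: if the end of the line is identified
    with its beginning, the moves between the gaps of the word form a
    permutation, and the orbit of the first gap is a cycle, so the traveller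
    reaches the last gap before coming back to the first. *)
Lemma route_journey D : gauss_diagram D -> route (word D) (word D) (journey D).
Proof.
move=> gD; have uw := gauss_uniq gD; have opw e := opp_in_word e gD.
rewrite /journey; set w := word D in uw opw *; set N := size w.
(* At the last gap, where there is no endpoint ahead, [next] goes back to 0. *)
pose next i := if onth w i is Some e then (index (opp_end e) w).+1 else 0%N.
have lt_next (i : 'I_N.+1) : (next i < N.+1)%N.
  rewrite /next; case wi: (onth w i) => [e|//].
  by rewrite ltnS index_mem opw; apply/onthP; exists i.
pose f i := Ordinal (lt_next i).
have injf : injective f.
  move=> i k /(congr1 val) /=; rewrite /next.
  case wi: (onth w i) => [e|]; case wk: (onth w k) => [e'|] //; last first.
    move=> _; apply: val_inj => /=; apply/eqP.
    have := onthTE w i; have := onthTE w k; rewrite wi wk.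
    move=> /esym/negbT; rewrite -leqNgt => ge_k /esym/negbT; rewrite -leqNgt => ge_i.
    by rewrite eqn_leq (leq_trans _ ge_k) ?(leq_trans _ ge_i) // -ltnS ltn_ord.
  case=> eq_ind; apply: val_inj => /=; apply: (onth_inj _ _ _ uw).
    have iw : (i < size w)%N by have := onthTE w i; rewrite wi => <-.
    by rewrite gtn_min iw ?orbT.
  have ew : opp_end e \in w by rewrite opw; apply/onthP; exists i.
  have ew' : opp_end e' \in w by rewrite opw; apply/onthP; exists k.
  rewrite wi wk; congr Some; apply: (inv_inj opp_endK).
  by rewrite -(nth_index e ew) eq_ind nth_index.
(* Whatever [n] exceeds of the number of steps to the last gap is unused fuel. *)
have reach n i k : (k <= n)%N -> val (iter k f i) = N ->
    route w (drop i w) (travel w n i).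
  elim: k n i => [|k IH] n i.
    move=> _ /= ->; rewrite drop_size; case: n => [|n] /=; first exact: route_nil.
    by rewrite onth_default //; exact: route_nil.
  case: n => // n; rewrite ltnS => le_kn; rewrite iterSr.
  move/(IH n _ le_kn); rewrite /= /next.
  case wi: (onth w i) => [e|] r; last first.
    have := onthNE w i; rewrite wi => /esym/drop_oversize ->; exact: route_nil.
  have ie : (i < size w)%N by have := onthTE w i; rewrite wi => <-.
  by rewrite (drop_nth e ie) (onth_nth e e _ _ wi); apply: route_cons.
have fN : f ord_max = ord0 by apply: val_inj; rewrite /= /next onth_default.
(* The last gap is the predecessor of the first one in its orbit. *)
rewrite -[X in route w X]drop0 -[0%N]/(val (ord0 : 'I_N.+1)).
apply: (@reach _ _ (fingraph.order f ord0).-1).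
  rewrite -ltnS prednK ?fingraph.order_gt0 // /N.
  by rewrite -[X in (_ <= X)%N]card_ord; apply: max_card.
by rewrite -[iter _ _ _]/(finv f ord0) -fN finv_f.
Qed.

(** Journeys only depend on which endpoints are opposite, so they commute both
    with renaming arrows and with crossing changes. *)
Lemma travel_map (B : finType) (h : A * bool -> B * bool) w n i :
    injective h -> {morph h : e / opp_end e >-> opp_end e} ->
  travel (map h w) n i = map h (travel w n i).
Proof.
move=> injh hopp; elim: n i => //= n IH i; rewrite onth_map.
by case: (onth w i) => //= e; rewrite -hopp index_map // IH.
Qed.

Lemma journey_map (B : finType) (h : A * bool -> B * bool) D (E : gauss_code B) :
    injective h -> {morph h : e / opp_end e >-> opp_end e} ->
  word E = map h (word D) -> journey E = map h (journey D).
Proof. by move=> injh hopp wE; rewrite /journey wE size_map travel_map. Qed.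

Definition ordered D (a : A) : bool :=
  (index (a, true) (journey D) < index (a, false) (journey D))%N.

Lemma ascendingE D :
  ascending D = one_component D && [forall a in crossings D, ordered D a].
Proof. by []. Qed.

Lemma one_component_map (B : finType) (h : A * bool -> B * bool) D (E : gauss_code B) :
    injective h -> {morph h : e / opp_end e >-> opp_end e} ->
  word E = map h (word D) -> one_component E = one_component D.
Proof.
move=> injh hopp wE; rewrite /one_component (journey_map injh hopp wE) wE all_map.
by apply: eq_all => e /=; rewrite mem_map.
Qed.


End Route.

Lemma index_filter (T : eqType) (p : pred T) (s : seq T) (a b : T) :
  p a -> p b ->
  (index a [seq c <- s | p c] < index b [seq c <- s | p c])%N
    = (index a s < index b s)%N.
Proof.
move=> pa pb; elim: s => //= c s IH; case: ifPn => /= [pc | npc].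
  by case: (c == a); case: (c == b) => //; rewrite ltnS IH.
have /negPf -> : c != a by apply: contraNneq npc => ->.
have /negPf -> : c != b by apply: contraNneq npc => ->.
by rewrite ltnS IH.
Qed.

Section After.

Variable A : finType.
Implicit Types (D : gauss_code A) (e : A * bool) (w u j : seq (A * bool)).

Lemma after_mid w u e : uniq (w ++ e :: u) -> after e (w ++ e :: u) = u.
Proof.
rewrite cat_uniq => /and3P[_ /hasPn/(_ e (mem_head _ _)) /= ew _].
rewrite /after index_cat (negPf ew) /= eqxx addn0.
by rewrite -addn1 addnC -drop_drop drop_size_cat //= drop0.
Qed.

Lemma after_split s w u e : uniq (w ++ s ++ u) -> e \in s ->
  after e (w ++ s ++ u) = after e s ++ u.
Proof.
move=> us es; case/splitPr: es us => s1 s2 us.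
have := us; rewrite -catA catA /= => us'; rewrite after_mid //.
congr (_ ++ _); rewrite after_mid //.
by move: us; rewrite cat_uniq => /and3P[_ _]; rewrite cat_uniq => /and3P[].
Qed.

Lemma cat_after s e : exists s', s = s' ++ after e s.
Proof. by exists (take (index e s).+1 s); rewrite cat_take_drop. Qed.

Lemma route_next w u j e c v : route w u j ->
  e \in j -> after (opp_end e) w = c :: v -> c \in j.
Proof.
elim=> // e' u' j' r IH; rewrite inE => /predU1P[-> eqc | ej eqc]; last first.
  by rewrite inE IH ?orbT.
by rewrite eqc in r; inversion r; subst; rewrite !inE eqxx orbT.
Qed.

(** The traveller arrives at an endpoint right after jumping away from the
    arrow whose endpoint comes just before it on the line. *)
Lemma journey_next D w d c u : gauss_diagram D ->
    word D = rcons w d ++ c :: u ->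
  opp_end d \in journey D -> c \in journey D.
Proof.
move=> gD wD dj; apply: (route_next (route_journey gD) dj (v := u)).
by rewrite opp_endK wD cat_rcons after_mid // -cat_rcons -wD gauss_uniq.
Qed.

Lemma journey_head D c u : gauss_diagram D -> word D = c :: u -> c \in journey D.
Proof.
move=> gD wD; have := route_journey gD; rewrite {2}wD => r.
by inversion r; rewrite mem_head.
Qed.

End After.

(** * The double smoothing *)

Section DoubleSmoothing.

Variables (A : finType) (D D0 : gauss_code A).
Variables (s0 s1 s2 s3 s4 : seq (A * bool)) (e1 e2 : A * bool).
Let e3 := opp_end e1.
Let e4 := opp_end e2.

Hypothesis gD : gauss_diagram D.
Hypothesis wD : word D = s0 ++ e1 :: s1 ++ e2 :: s2 ++ e3 :: s3 ++ e4 :: s4.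
Hypothesis wD0 : word D0 = s0 ++ s3 ++ s2 ++ s1 ++ s4.

(** [same_spot u0 u] relates what lies ahead of the traveller in [word D0] to
    what lies ahead in [word D] when standing at the same place of the same
    segment: after [s0] comes [s3] on one side and [e1], which leads to [s3], on
    the other. *)
Inductive same_spot : seq (A * bool) -> seq (A * bool) -> Prop :=
| same_spot0 t u : s0 = t ++ u -> same_spot (u ++ s3 ++ s2 ++ s1 ++ s4)
    (u ++ e1 :: s1 ++ e2 :: s2 ++ e3 :: s3 ++ e4 :: s4)
| same_spot3 t u : s3 = t ++ u -> same_spot (u ++ s2 ++ s1 ++ s4) (u ++ e4 :: s4)
| same_spot2 t u : s2 = t ++ u -> same_spot (u ++ s1 ++ s4) (u ++ e3 :: s3 ++ e4 :: s4)
| same_spot1 t u : s1 = t ++ u ->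
    same_spot (u ++ s4) (u ++ e2 :: s2 ++ e3 :: s3 ++ e4 :: s4)
| same_spot4 t u : s4 = t ++ u -> same_spot u u.

Lemma perm_word_smoothing :
  perm_eq (word D) ([:: e1; e2; e3; e4] ++ word D0).
Proof.
rewrite wD wD0; apply/permP => p.
do 10! rewrite /= ?count_cat; lia.
Qed.

Let uD : uniq ([:: e1; e2; e3; e4] ++ word D0).
Proof. by rewrite -(perm_uniq perm_word_smoothing) gauss_uniq. Qed.

Lemma gauss_diagram_smoothing : gauss_diagram D0.
Proof.
have memD c : (c \in word D) = (c \in [:: e1; e2; e3; e4]) || (c \in word D0).
  by rewrite (perm_mem perm_word_smoothing) mem_cat.
have opp4 c : (opp_end c \in [:: e1; e2; e3; e4]) = (c \in [:: e1; e2; e3; e4]).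
  rewrite !inE /e3 /e4 -!(inv_eq (@opp_endK A)) !opp_endK.
  by case: (c == e1); case: (c == e2); rewrite ?orbT ?orbF //= orbC.
move: uD; rewrite cat_uniq => /and3P[_ /hasPn not4 u0].
rewrite /gauss_diagram u0; apply/allP => c c0; have := not4 _ c0.
rewrite /= -opp4 => /negPf n4; have := memD (opp_end c).
by rewrite n4 opp_in_word // memD c0 orbT /= => <-.
Qed.

Let gD0 := gauss_diagram_smoothing.

(** Jumping along an arrow common to both diagrams lands at the same place of
    the same segment. *)
Lemma same_spot_after c : c \in word D0 ->
  same_spot (after c (word D0)) (after c (word D)).
Proof.
have jump s p q p0 q0 : c \in s -> word D0 = p0 ++ s ++ q0 -> word D = p ++ s ++ q ->
    (forall t u, s = t ++ u -> same_spot (u ++ q0) (u ++ q)) ->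
    same_spot (after c (word D0)) (after c (word D)).
  move=> cs w0 w spot; have [t /spot] := cat_after s c.
  by rewrite w0 w !after_split -?w0 -?w ?gauss_uniq.
rewrite [in X in X -> _]wD0 !mem_cat => /or4P[|||/orP[]] cs.
- by apply: (jump _ [::] _ [::] _ cs wD0 wD); exact: same_spot0.
- apply: (jump _ (s0 ++ e1 :: s1 ++ e2 :: s2 ++ [:: e3]) (e4 :: s4) s0 (s2 ++ s1 ++ s4) cs).
  + by rewrite wD0.
  + by rewrite wD -!catA /= -!catA /= -!catA.
  + exact: same_spot3.
- apply: (jump _ (s0 ++ e1 :: s1 ++ [:: e2]) _ (s0 ++ s3) (s1 ++ s4) cs).
  + by rewrite wD0 -!catA.
  + by rewrite wD -!catA /= -!catA.
  + exact: same_spot2.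
- apply: (jump _ (s0 ++ [:: e1]) _ (s0 ++ s3 ++ s2) s4 cs).
  + by rewrite wD0 -!catA.
  + by rewrite wD -!catA.
  + exact: same_spot1.
- apply: (jump _ (s0 ++ e1 :: s1 ++ e2 :: s2 ++ e3 :: s3 ++ [:: e4]) [::]
      (s0 ++ s3 ++ s2 ++ s1) [::] cs).
  + by rewrite wD0 -!catA cats0.
  + by rewrite wD -!catA /= -!catA /= -!catA /= -!catA /= cats0.
  + by move=> t u tu; rewrite cats0; exact: same_spot4 tu.
Qed.

Let end_notin0 e : e \in [:: e1; e2; e3; e4] -> e \notin word D0.
Proof.
move=> e4in; apply: contraL e4in.
by move: uD; rewrite cat_uniq => /and3P[_ /hasPn + _]; apply.
Qed.

(** At the end of a segment of [D], the jump along one of the two smoothed arrows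
    leads to the beginning of the segment which follows in [D0]; nothing happens
    in [D0] meanwhile. *)
Lemma same_spot_cons u0 e u : same_spot u0 (e :: u) ->
  (if e \in word D0 then exists v, u0 = e :: v
   else same_spot u0 (after (opp_end e) (word D))).
Proof.
have jump p q c : word D = p ++ c :: q -> after c (word D) = q.
  by move=> w; rewrite w after_mid // -w gauss_uniq.
have after1 : after e1 (word D) = s1 ++ e2 :: s2 ++ e3 :: s3 ++ e4 :: s4.
  exact: (jump s0).
have after2 : after e2 (word D) = s2 ++ e3 :: s3 ++ e4 :: s4.
  by apply: (jump (s0 ++ e1 :: s1)); rewrite wD -!catA.
have after3 : after e3 (word D) = s3 ++ e4 :: s4.
  by apply: (jump (s0 ++ e1 :: s1 ++ e2 :: s2)); rewrite wD -!catA /= -!catA.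
have after4 : after e4 (word D) = s4.
  apply: (jump (s0 ++ e1 :: s1 ++ e2 :: s2 ++ e3 :: s3)).
  by rewrite wD -!catA /= -!catA /= -!catA.
have in0 i : e \in nth [::] [:: s0; s1; s2; s3; s4] i -> e \in word D0.
  case: i => [|[|[|[|[|i]]]]]; rewrite /= ?nth_nil // => es;
    by rewrite wD0 !mem_cat es ?orbT.
move Ew: (e :: u) => w spot.
case: spot Ew in0 => t [|c v] sE //= [-> _] in0.
- rewrite (negPf (end_notin0 _)) ?inE ?eqxx // after3.
  exact: (same_spot3 (t := [::])).
- by rewrite (in0 0%N) /= ?sE ?mem_cat ?mem_head ?orbT //; exists (v ++ s3 ++ s2 ++ s1 ++ s4).
- rewrite (negPf (end_notin0 _)) ?inE ?eqxx ?orbT // opp_endK after2.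
  exact: (same_spot2 (t := [::])).
- by rewrite (in0 3%N) /= ?sE ?mem_cat ?mem_head ?orbT //; exists (v ++ s2 ++ s1 ++ s4).
- rewrite (negPf (end_notin0 _)) ?inE ?eqxx ?orbT // opp_endK after1.
  exact: (same_spot1 (t := [::])).
- by rewrite (in0 2%N) /= ?sE ?mem_cat ?mem_head ?orbT //; exists (v ++ s1 ++ s4).
- rewrite (negPf (end_notin0 _)) ?inE ?eqxx ?orbT // after4.
  exact: (same_spot4 (t := [::])).
- by rewrite (in0 1%N) /= ?sE ?mem_cat ?mem_head ?orbT //; exists (v ++ s4).
- by rewrite (in0 4%N) /= ?sE ?mem_cat ?mem_head ?orbT //; exists v.
Qed.

Lemma route_smoothing u0 u j : same_spot u0 u -> route (word D) u j ->
  route (word D0) u0 [seq c <- j | c \in word D0].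
Proof.
move=> spot r; elim: r u0 spot => [|e v k r IH] u0 spot.
  have -> : u0 = [::]; last exact: route_nil.
  move Ew: [::] spot => w spot; case: spot Ew => t u1 _ //=; by case: u1.
move/same_spot_cons: (spot) => /=; case: ifP => [e0 [v0 ->] | _ /IH //].
apply: route_cons; apply: IH; apply: same_spot_after.
by rewrite opp_in_word.
Qed.

Lemma journey_smoothing : journey D0 = [seq c <- journey D | c \in word D0].
Proof.
apply: (route_functional (route_journey gD0)).
apply: route_smoothing (route_journey gD).
by rewrite wD wD0; exact: (@same_spot0 [::]).
Qed.

(** The filtering of journeys settles one direction.  For the other, it must be
    excluded that the smoothed endpoints lie on a closed component of their own:
    each of them follows a common endpoint, the beginning of the line or
    another smoothed endpoint, hence is reached as soon as those are. *)
Lemma one_component_smoothing : one_component D0 = one_component D.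
Proof.
have in_journey0 c : c \in word D0 -> (c \in journey D0) = (c \in journey D).
  by move=> c0; rewrite journey_smoothing mem_filter c0.
apply/allP/allP => visited c cw; last first.
  rewrite in_journey0 //; apply: visited.
  by rewrite (perm_mem perm_word_smoothing) mem_cat cw orbT.
have after_segment p s q e : word D = p ++ s ++ e :: q -> {subset s <= word D0} ->
    (s = [::] -> e \in journey D) -> e \in journey D.
  case/lastP: s => [|s d] w sub; first exact.
  move=> _; rewrite catA -rcons_cat in w; apply: (journey_next gD w).
  have d0 : opp_end d \in word D0 by rewrite opp_in_word // sub // mem_rcons mem_head.
  by rewrite -in_journey0 // visited.
have sub i : {subset nth [::] [:: s0; s1; s2; s3; s4] i <= word D0}.
  move=> e; case: i => [|[|[|[|[|i]]]]]; rewrite /= ?nth_nil // => es;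
    by rewrite wD0 !mem_cat es ?orbT.
(* When the preceding segment is empty, [e4] is reached from [e1], [e3] from
   [e4], and [e2] from [e3], whence the order of the next four steps. *)
have v1 : e1 \in journey D.
  apply: (after_segment [::] _ _ _ wD (sub 0%N : {subset s0 <= word D0})) => z.
  by move: wD; rewrite z; exact: journey_head.
have v4 : e4 \in journey D.
  apply: (after_segment (s0 ++ e1 :: s1 ++ e2 :: s2 ++ [:: e3]) _ s4 _ _
            (sub 3%N : {subset s3 <= word D0})).
    by rewrite wD -!catA /= -!catA /= -!catA.
  move=> z; apply: (@journey_next _ _ (s0 ++ e1 :: s1 ++ e2 :: s2) e3 _ s4 gD).
    by rewrite wD z cat_rcons -!catA /= -!catA.
  by rewrite opp_endK.
have v3 : e3 \in journey D.
  apply: (after_segment (s0 ++ e1 :: s1 ++ [:: e2]) _ _ _ _ (sub 2%N : {subset s2 <= word D0})).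
    by rewrite wD -!catA /= -!catA.
  move=> z; apply: (@journey_next _ _ (s0 ++ e1 :: s1) e2 _ (s3 ++ e4 :: s4) gD) => //.
  by rewrite wD z cat_rcons -!catA.
have v2 : e2 \in journey D.
  apply: (after_segment (s0 ++ [:: e1]) _ _ _ _ (sub 1%N : {subset s1 <= word D0})).
    by rewrite wD -!catA.
  move=> z; apply: (@journey_next _ _ s0 e1 _ (s2 ++ e3 :: s3 ++ e4 :: s4) gD) => //.
  by rewrite wD z cat_rcons.
move: cw; rewrite (perm_mem perm_word_smoothing) mem_cat => /orP[|c0].
  by rewrite !inE => /or4P[] /eqP ->.
by rewrite -in_journey0 // visited.
Qed.

Lemma ordered_smoothing a : a \in crossings D0 -> ordered D0 a = ordered D a.
Proof.
by move=> a0; rewrite /ordered journey_smoothing index_filter ?end_in_word.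
Qed.

Lemma crossings_smoothing : crossings D0 = crossings D :\: [set e1.1; e2.1].
Proof.
apply/setP => a; rewrite in_setD in_set2 -!(end_in_word _ true) //.
have in4 : ((a, true) \in [:: e1; e2; e3; e4]) = (a == e1.1) || (a == e2.1).
  have pairE e : ((a, true) == e) || ((a, true) == opp_end e) = (a == e.1).
    by case: e => b []; rewrite /opp_end !xpair_eqE /= ?andbT ?andbF ?orbF.
  by rewrite !inE -!pairE -/e3 -/e4 -!orbA; do !bool_congr.
rewrite (perm_mem perm_word_smoothing) mem_cat in4 -in4.
by case: (boolP (_ \in [:: _; _; _; _])) => [/end_notin0/negPf|] //.
Qed.

End DoubleSmoothing.

(** * Conway coefficients as sums over subdiagrams *)

Lemma crossings_subdiagram (A : finType) (D : gauss_code A) (S : {set A}) :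
  S \subset crossings D -> crossings (subdiagram D S) = S.
Proof.
move=> /subsetP sub; apply/setP => a; rewrite inE; apply/mapP/idP.
  by case=> e; rewrite mem_filter => /andP[+ _] ->.
move=> aS; have := sub _ aS; rewrite inE => /mapP[e ew ae].
by exists e; rewrite // mem_filter -ae aS.
Qed.

Lemma gauss_subdiagram (A : finType) (D : gauss_code A) (S : {set A}) :
  gauss_diagram D -> gauss_diagram (subdiagram D S).
Proof.
move=> gD; rewrite /gauss_diagram filter_uniq ?gauss_uniq //=.
apply/allP => e; rewrite !mem_filter opp_in_word //.
Qed.

Lemma card_word (A : finType) (D : gauss_code A) :
  gauss_diagram D -> size (word D) = #|crossings D|.*2.
Proof.
move=> gD; rewrite -(card_uniqP (gauss_uniq gD)) -muln2 -card_bool -cardsT -cardsX.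
by apply: eq_card => -[a b]; rewrite end_in_word // !inE andbT.
Qed.

(** The comparison with words and signs makes Gauss codes an eqType, which
    the lemmas about sums and lists of diagrams require. *)
Definition gauss_code_pair (A : finType) (D : gauss_code A) := (word D, sgn D).

Lemma gauss_code_pairK (A : finType) :
  cancel (@gauss_code_pair A) (fun p => GaussCode p.1 p.2).
Proof. by case. Qed.

HB.instance Definition _ (A : finType) :=
  Equality.copy (gauss_code A) (can_type (@gauss_code_pairK A)).

Lemma map_uniq_inj (T U : eqType) (f : T -> U) (s : seq T) :
  uniq (map f s) -> {in s &, injective f}.
Proof.
elim: s => //= t s IH /andP[ft /IH inj] u v.
rewrite !inE => /predU1P[->|us] /predU1P[->|vs] // eqf; last exact: inj.
- by rewrite eqf map_f in ft.
- by rewrite -eqf map_f in ft.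
Qed.

Section Relabel.

Variables (A B : finType) (D : gauss_code A) (E : gauss_code B) (phi : A -> B).
Hypothesis gD : gauss_diagram D.
Hypothesis inj_phi : injective phi.
Hypothesis wE : word E = [seq (phi e.1, e.2) | e <- word D].
Hypothesis sE : {in crossings D, forall a, sgn E (phi a) = sgn D a}.

Let h (e : A * bool) := (phi e.1, e.2).

Let inj_h : injective h.
Proof. by move=> [a b] [a' b'] [/inj_phi -> ->]. Qed.

Lemma crossings_relabel : crossings E = phi @: crossings D.
Proof.
apply/setP => b; rewrite inE wE -map_comp; apply/mapP/imsetP => [[e ew ->]|[a]].
  by exists e.1; rewrite // inE map_f.
by rewrite inE => /mapP[e ew -> ->]; exists e.
Qed.

Lemma ascending_relabel : ascending E = ascending D.
Proof.
rewrite !ascendingE (one_component_map inj_h (fun=> erefl) wE); congr (_ && _).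
have ordE a : ordered E (phi a) = ordered D a.
  rewrite /ordered (journey_map inj_h (fun=> erefl) wE).
  by rewrite -![(phi a, _)]/(h (a, _)) !index_map.
rewrite crossings_relabel; apply/forall_inP/forall_inP => ord a aD.
  by rewrite -ordE ord ?imset_f.
by case/imsetP: aD => b bD ->; rewrite ordE ord.
Qed.

Lemma weight_relabel : weight E = weight D.
Proof.
rewrite /weight crossings_relabel big_imset /=; last by move=> ? ? _ _ /inj_phi.
by apply: eq_bigr => a /sE ->.
Qed.

End Relabel.

Section Coefficient.

Variables (A : finType) (a0 : A).
Implicit Types (D : gauss_code A) (S : {set A}).

(** The contribution of a diagram to its Conway coefficient, labels apart. *)
Definition ascending_weight D : int := if ascending D then weight D else 0.

Lemma diagram_forget (B C : finType) (D : gauss_code B) (E : gauss_code C) L M :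
  diagram (D, L) = diagram (E, M) ->
  diagram (D, fun=> None) = diagram (E, fun=> None).
Proof.
move/(congr1 (map (fun q : nat * bool * bool * natinf => (q.1, None : natinf)))).
by rewrite -!map_comp.
Qed.

Lemma eq_diagram_labels (B : finType) (E : gauss_code B) (M L : B -> natinf) :
  (diagram (E, M) == diagram (E, L)) = [forall b in crossings E, M b == L b].
Proof.
apply/eqP/forall_inP => [/eq_in_map eqML b | eqML].
  by rewrite inE => /mapP[e ew ->]; have [->] := eqML e ew.
apply/eq_in_map => e ew; congr (_, _); apply/eqP/eqML.
by rewrite inE map_f.
Qed.

(** Among all the diagrams with [k] arrows exactly one, up to labels, is [D]; [psi]
    identifies its arrows with those of [D], and the match is then decided by
    the labels. *)
Lemma sum_matching_diagrams k D : gauss_diagram D -> #|crossings D| = k ->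
  exists2 psi : 'I_k -> A, crossings D = psi @: setT &
  forall M L,
    \sum_(E <- all_diagrams k | ascending E)
        weight E * (diagram (E, M) == diagram (D, L))%:R
      = ascending_weight D * [forall i, M i == L (psi i)]%:R.
Proof.
move=> gD kD; have := mem_all_diagrams gD; rewrite kD => /mapP[E Ein eqDE].
have [gE cE] : gauss_diagram E /\ crossings E = setT.
  move: Ein; case/allpairsP=> -[w s] /= [+ _ ->]; rewrite mem_filter => /andP[_].
  exact: all_diagrams_gauss.
have [psi [inj_psi wD sD _]] := (@diagram_eqP _ _ a0 (E, _) (D, _) gE gD).1 (esym eqDE).
rewrite /= cE in inj_psi wD sD; have {}inj_psi : injective psi.
  by move=> i j; apply: inj_psi; rewrite inE.
have sD' : {in crossings E, forall a, sgn D (psi a) = sgn E a} by rewrite cE.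
have relabel L : diagram (D, L) = diagram (E, L \o psi).
  apply/esym/(@diagram_eqP _ _ a0 (E, _) (D, _)) => //.
  by exists psi; split=> //= ? ? _ _ /inj_psi.
exists psi => [|M L].
  by rewrite (crossings_relabel wD) cE.
rewrite /ascending_weight (ascending_relabel inj_psi wD) (weight_relabel inj_psi wD sD').
have other E' : E' \in all_diagrams k -> E' != E ->
    weight E' * (diagram (E', M) == diagram (D, L))%:R = 0.
  move=> E'in neq; case: eqP => [/diagram_forget|]; last by rewrite mulr0.
  rewrite eqDE => /(map_uniq_inj (uniq_all_diagrams k)) eqE.
  by rewrite eqE ?eqxx in neq.
rewrite big_mkcond (bigD1_seq E) //=; last exact: map_uniq (uniq_all_diagrams k).
rewrite [X in _ + X]big_seq_cond [X in _ + X]big1 ?addr0; last first.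
  by move=> E' /andP[E'in neq]; rewrite other ?if_same.
case: ifP => _; last by rewrite mul0r.
rewrite relabel eq_diagram_labels cE; congr (_ * (nat_of_bool _)%:R).
by apply: eq_forallb => i; rewrite inE.
Qed.

Lemma mismatched_diagrams k D M L E : gauss_diagram D -> #|crossings D| != k ->
  E \in all_diagrams k -> (diagram (E, M) == diagram (D, L)) = false.
Proof.
move=> gD kD /allpairsP[[w s] /= [+ _ ->]]; rewrite mem_filter => /andP[_ pw].
apply: contraNF kD => /eqP/(congr1 size); rewrite !size_map /= card_word //.
have [gE cE] := all_diagrams_gauss s pw.
by rewrite -[w]/(word (GaussCode w s)) card_word // cE cardsT card_ord => /double_inj ->.
Qed.

(** The labels of subdiagrams counted by the even or by the odd formula, in terms
    of the labels for m infinite.  The two cases exclude each other, as an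
    infinite label exceeds any [k]. *)
Definition selected (m : natinf) (L : A -> natinf) S : bool :=
  [forall a in S, L a == None]
  || (if m is Some k then [exists a in S, if L a is Some j then (j <= k)%N else false]
      else false).

Lemma flabel_gt0 m D a j : flabel m D a = Some j -> (0 < j)%N.
Proof.
rewrite /flabel; case: excluded_middle_informative => [ex|_].
  by case: ex_minnP => i /and3P[i0 _ _] _ [<-].
by case: m => //= k [<-].
Qed.

(** An arrow which survives [k] rounds gets the label [k.+1], whether it is
    removed later or never. *)
Lemma flabel_Some k D a :
  flabel (Some k) D a
  = if flabel None D a is Some j then Some (if (j <= k)%N then j else k.+1)
    else Some k.+1.
Proof.
rewrite /flabel; case: excluded_middle_informative => [exk|nexk];
  case: excluded_middle_informative => [ex|nex] //=.
- case: ex_minnP => i /and3P[i0 ik ia] mini; case: ex_minnP => j /and3P[j0 _ ja] minj.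
  have ji : (j <= i)%N by apply: minj; rewrite /removed_at i0 ia.
  have jk : (j <= k)%N := leq_trans ji ik.
  rewrite jk; congr Some; apply/eqP; rewrite eqn_leq ji andbT.
  by apply: mini; rewrite /removed_at j0 ja /= jk.
- by have [i /and3P[i0 _ ia]] := exk; case: nex; exists i; rewrite /removed_at i0 ia.
- case: ex_minnP => j /and3P[j0 _ ja] minj; case: ifP => // jk.
  by case: nexk; exists j; rewrite /removed_at j0 ja /= jk.
Qed.

(** The labels of the even formula are all infinite, and those of the odd one run
    over all labellings but one; for a given subdiagram at most one labelling
    matches, so that the odd formula selects the subdiagrams with a label other
    than [k.+1]. *)
Lemma conway_coefE n m D : gauss_diagram D ->
  conway_coef n m D =
    \sum_(S : {set A} | [&& S \subset crossings D, #|S| == n.*2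
                         & selected m (flabel None D) S])
      ascending_weight (subdiagram D S).
Proof.
move=> gD; have gS S := gauss_subdiagram S gD.
have cS := @crossings_subdiagram A D.
have pairI a X L : pairing << a *g X >> (I_map (D, L)) =
    \sum_(S : {set A} | S \subset crossings D)
       a * (X == diagram (subdiagram D S, L))%:R.
  rewrite /I_map (big_morph _ (pairingDr _) (pairing0r _)).
  by apply: eq_bigr => S _; rewrite pairingU mulr1.
have even : pairing (C_even n None) (I_map (Lambda None D)) =
    \sum_(S : {set A} | (S \subset crossings D) && (#|S| == n.*2))
      ascending_weight (subdiagram D S) * [forall a in S, flabel None D a == None]%:R.
  rewrite /C_even (big_morph _ (pairingDl _) (pairing0l _)).
  under eq_bigr => E _ do rewrite pairI.
  rewrite exchange_big /= [RHS]big_mkcondr /=; apply: eq_bigr => S /cS cSE.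
  case: eqP => [/eqP|]; rewrite -{1}cSE => nS; last first.
    rewrite big_seq_cond big1 // => E /andP[Ein _].
    by rewrite mismatched_diagrams // ?mulr0 //; apply/eqP.
  have [psi im_psi ->] := sum_matching_diagrams (gS S) (eqP nS).
  congr (_ * (nat_of_bool _)%:R); rewrite -{1}cSE im_psi.
  apply/forallP/forall_inP => [all_None a /imsetP[i _ ->]|all_None i].
    by rewrite eq_sym.
  by rewrite eq_sym all_None ?imset_f.
have odd : pairing (C_odd n m) (I_map (Lambda m D)) =
    \sum_(S : {set A} | (S \subset crossings D) && (#|S| == n.*2))
      ascending_weight (subdiagram D S)
      * (if m is Some k then [exists a in S,
           if flabel None D a is Some j then (j <= k)%N else false] else false)%:R.
  case: m => [k|] /=; last first.
    by rewrite pairing0l big1 // => S _; rewrite mulr0.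
  rewrite (big_morph _ (pairingDl _) (pairing0l _)).
  under eq_bigr => E _.
    rewrite (big_morph _ (pairingDl _) (pairing0l _)).
    under eq_bigr => l _ do rewrite pairI.
    rewrite exchange_big /=.
    over.
  rewrite exchange_big /= [RHS]big_mkcondr /=; apply: eq_bigr => S /cS cSE.
  case: eqP => [/eqP|]; rewrite -{1}cSE => nS; last first.
    rewrite big_seq_cond big1 // => E /andP[Ein _]; rewrite big1 // => l _.
    by rewrite mismatched_diagrams // ?mulr0 //; apply/eqP.
  have [psi im_psi match_psi] := sum_matching_diagrams (gS S) (eqP nS).
  rewrite exchange_big /=.
  under eq_bigr => l _ do rewrite match_psi.
  have psiS i : psi i \in S by rewrite -cSE im_psi imset_f.
  (* The only labelling which can match; labels start from 1, so that taking
     the predecessor loses nothing. *)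
  pose l0 : {ffun 'I_n.*2 -> 'I_k.+1} :=
    [ffun i => inord (odflt 0%N (flabel (Some k) D (psi i))).-1].
  have l0E i : Some (l0 i).+1 = flabel (Some k) D (psi i) :> natinf.
    rewrite ffunE flabel_Some; case E: (flabel None D (psi i)) => [j|]; last first.
      by rewrite inordK.
    have j0 := flabel_gt0 E.
    case: leqP => jk; rewrite inordK /= ?prednK //; exact: leqW.
  rewrite -mulr_sumr; congr (_ * _).
  rewrite big_mkcond (bigD1 l0) //= big1 ?addr0; last first.
    move=> l /eqP neq; case: ifP => // _; case: forallP => // eql; case: neq.
    by apply/ffunP => i; have /eqP := eql i; rewrite -l0E => -[/val_inj].
  have -> : [forall i, (Some (l0 i).+1 : natinf) == flabel (Some k) D (psi i)].
    by apply/forallP => i; rewrite l0E.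
  have -> : [exists a, (l0 a).+1 != k.+1] = [exists a in S,
      if flabel None D a is Some j then (j <= k)%N else false].
    have lE i : ((l0 i).+1 != k.+1) =
        if flabel None D (psi i) is Some j then (j <= k)%N else false.
      have := l0E i; rewrite flabel_Some; case E: (flabel None D (psi i)) => [j|] [->].
        by case: leqP => jk; rewrite ?eqxx // ltn_eqF.
      by rewrite eqxx.
    apply/existsP/exists_inP => [[i li]|[a]]; first by exists (psi i); rewrite // -lE.
    rewrite -cSE im_psi => /imsetP[i _ ->] li; by exists i; rewrite lE.
  by case: ifP.
rewrite /conway_coef even odd -big_split /= [RHS](eq_bigl _ _ (fun S => andbA _ _ _)).
rewrite [RHS]big_mkcondr /=; apply: eq_bigr => S _; rewrite -mulrDr /selected.
case: forall_inP => [allN|_] /=; last first.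
  rewrite add0r; case: m {odd} => [k|]; last by rewrite mulr0.
  by case: exists_inP; rewrite ?mulr0 ?mulr1.
rewrite mulrDr mulr1; case: m {odd} => [k|]; last by rewrite mulr0 addr0.
case: exists_inP => [[a aS]|_]; last by rewrite mulr0 addr0.
by rewrite (eqP (allN a aS)).
Qed.

End Coefficient.

(** * Crossing changes *)

Section CrossingChange.

Variable A : finType.
Implicit Types (D : gauss_code A) (a b x y : A) (S : {set A}).

Definition flip a (e : A * bool) := (e.1, (e.1 == a) (+) e.2).

Lemma flipK a : involutive (flip a).
Proof. by case=> b c; rewrite /flip /= addKb. Qed.

Lemma flip_opp a : {morph flip a : e / opp_end e}.
Proof. by case=> b c; rewrite /flip /opp_end /= addbN. Qed.

Lemma crossing_changeC a b D :
  crossing_change a (crossing_change b D) = crossing_change b (crossing_change a D).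
Proof.
rewrite /crossing_change /= -!map_comp; congr GaussCode.
  by apply: eq_map => e; rewrite /= addbCA.
by apply/ffunP => c; rewrite !ffunE addbCA.
Qed.

Lemma subdiagram_crossing_change a D S :
  subdiagram (crossing_change a D) S = crossing_change a (subdiagram D S).
Proof. by rewrite /subdiagram /crossing_change /= filter_map. Qed.

Lemma crossings_crossing_change a D : crossings (crossing_change a D) = crossings D.
Proof. by apply/setP => b; rewrite !inE -map_comp. Qed.

Lemma gauss_crossing_change a D :
  gauss_diagram D -> gauss_diagram (crossing_change a D).
Proof.
move=> gD; have inj := inv_inj (flipK a).
rewrite /gauss_diagram map_inj_uniq //= gauss_uniq //=.
apply/allP => _ /mapP[e ew ->]; rewrite -/(flip a e) -flip_opp.
by rewrite (mem_map inj) opp_in_word.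
Qed.

Lemma linked_crossing_change a D : linked (crossing_change a D) =2 linked D.
Proof. by move=> b c; rewrite /linked /= filter_map -map_comp. Qed.

Lemma parity_map_crossing_change a D :
  parity_map (crossing_change a D) = crossing_change a (parity_map D).
Proof.
rewrite /parity_map subdiagram_crossing_change; congr (crossing_change _ (subdiagram _ _)).
apply/setP => b; rewrite !inE /odd_arrow; congr (~~ odd _).
by apply: eq_card => c; rewrite in_set crossings_crossing_change linked_crossing_change [RHS]in_set.
Qed.

Lemma removed_crossing_change a m D :
  removed_at m (crossing_change a D) =2 removed_at m D.
Proof.
move=> b i; rewrite /removed_at; congr [&& _, _ & b \notin _].
elim: i D => [|i IH] D; first by rewrite crossings_crossing_change.
by rewrite !iterSr parity_map_crossing_change IH.
Qed.

Lemma flabel_crossing_change a m D : flabel m (crossing_change a D) =1 flabel m D.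
Proof.
move=> b; have eqr := removed_crossing_change a m D b.
rewrite /flabel; case: excluded_middle_informative => [ex|nex];
  case: excluded_middle_informative => [ex'|nex'] //.
- by congr Some; apply: eq_ex_minn.
- by case: nex'; have [i] := ex; exists i; rewrite -eqr.
- by case: nex; have [i] := ex'; exists i; rewrite eqr.
Qed.

Lemma one_component_crossing_change a D :
  one_component (crossing_change a D) = one_component D.
Proof. exact: (one_component_map (inv_inj (flipK a)) (flip_opp a)). Qed.

(** A crossing change reverses the order of the two passes along its arrow.  One
    component is needed: both endpoints must be met for the orders to be
    strict. *)
Lemma ordered_crossing_change a b D : gauss_diagram D -> one_component D ->
  b \in crossings D -> ordered (crossing_change a D) b = (b == a) (+) ordered D b.
Proof.
move=> gD /allP oD bD; have inj := inv_inj (flipK a).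
have E c : index (b, c) (journey (crossing_change a D)) =
    index (b, (b == a) (+) c) (journey D).
  rewrite (@journey_map _ _ _ D _ inj (flip_opp a)) //.
  by rewrite -[(b, c)](flipK a) index_map.
rewrite /ordered !E; case: (b == a) => //=; rewrite ltn_neqAle -leqNgt andb_idl // => le.
have visited c : (b, c) \in journey D by apply: oD; rewrite end_in_word.
by apply/eqP => eq_index; have := nth_index (b, true) (visited true); rewrite -eq_index nth_index.
Qed.

Lemma weight_crossing_change a D : a \in crossings D ->
  weight (crossing_change a D) = - weight D.
Proof.
move=> aD; rewrite /weight crossings_crossing_change !(bigD1 a aD) /= ffunE eqxx -mulNr.
congr (_ * _); first by case: (sgn D a).
by apply: eq_bigr => b /andP[_ /negPf ba]; rewrite ffunE ba.
Qed.

Lemma ascending_weight_crossing_change a D : gauss_diagram D -> a \notin crossings D ->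
  ascending_weight (crossing_change a D) = ascending_weight D.
Proof.
move=> gD aD; rewrite /ascending_weight !ascendingE one_component_crossing_change.
have wE : weight (crossing_change a D) = weight D.
  rewrite /weight crossings_crossing_change; apply: eq_bigr => b bD.
  by rewrite ffunE; case: eqP bD aD => // -> ->.
rewrite wE crossings_crossing_change; case oD: (one_component D) => //=.
congr (if _ then _ else _); apply: eq_forallb_in => b bD.
by rewrite ordered_crossing_change //; case: eqP bD aD => // -> ->.
Qed.

(** The four terms run over the four choices of directions of [x] and [y]: each
    one-component diagram becomes ascending at [x] and [y] for exactly one of
    them, and the sign of the term compensates the change of weight. *)
Lemma alternating_sum x y D : gauss_diagram D -> x != y ->
  ascending_weight D - ascending_weight (crossing_change y D)
    - ascending_weight (crossing_change x D)
    + ascending_weight (crossing_change x (crossing_change y D))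
  = if [&& [set x; y] \subset crossings D, one_component D
         & [forall a in crossings D :\: [set x; y], ordered D a]]
    then weight D else 0.
Proof.
move=> gD xy; rewrite subUset !sub1set.
have gC a := gauss_crossing_change a gD.
have [xD|xD] := boolP (x \in crossings D); last first.
  rewrite !(@ascending_weight_crossing_change x) ?crossings_crossing_change //=.
  by rewrite [_ - _ - _]addrAC subrr sub0r addNr.
have [yD|yD] := boolP (y \in crossings D); last first.
  rewrite crossing_changeC !(@ascending_weight_crossing_change y) //;
    rewrite ?crossings_crossing_change //=.
  by rewrite subrr sub0r addNr.
have split_forall (P : pred A) : [forall a in crossings D, P a]
    = [&& P x, P y & [forall a in crossings D :\: [set x; y], P a]].
  apply/forall_inP/and3P => [PD|[Px Py /forall_inP PD] a aD].
    split; rewrite ?PD //; apply/forall_inP => a /setDP[aD _]; exact: PD.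
  have [->//|ax] := eqVneq a x; have [->//|ay] := eqVneq a y.
  by apply: PD; rewrite in_setD in_set2 negb_or ax ay.
rewrite /ascending_weight !ascendingE !one_component_crossing_change.
rewrite !weight_crossing_change ?crossings_crossing_change //.
have [oD|_] /= := boolP (one_component D); last by rewrite ?subr0 ?addr0.
have oC c : one_component (crossing_change c D) by rewrite one_component_crossing_change.
have rest c D' : gauss_diagram D' -> one_component D' -> crossings D' = crossings D ->
    c \in [set x; y] ->
    [forall a in crossings D :\: [set x; y], ordered (crossing_change c D') a]
    = [forall a in crossings D :\: [set x; y], ordered D' a].
  move=> gD' oD' cD' cxy; apply: eq_forallb_in => a /setDP[aD axy].
  by rewrite ordered_crossing_change ?cD' //; case: eqP axy => // ->; rewrite cxy.
rewrite !split_forall !rest ?set21 ?set22 ?crossings_crossing_change //.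
rewrite !ordered_crossing_change ?crossings_crossing_change //.
rewrite !eqxx [y == x]eq_sym (negPf xy) /=.
case: (ordered D x); case: (ordered D y); case: [forall _ in _, _] => //=;
  by rewrite ?opprK ?subr0 ?sub0r ?add0r ?addr0 ?opprK.
Qed.

End CrossingChange.

(** * The Conway relation *)

Section ConwayRelation.

Variables (A : finType) (x y : A) (D D0 : gauss_code A).
Hypothesis gD : gauss_diagram D.
Hypothesis xy : x != y.
Hypothesis smoothD : double_smoothing x y D D0.

(** The four endpoints are those of two arrows, so that the last two are the
    opposites of the first two; which of [x] and [y] comes first is forgotten. *)
Lemma double_smoothing_ends :
  exists s0 s1 s2 s3 s4 : seq (A * bool), exists e1 e2 : A * bool,
  [/\ word D = s0 ++ e1 :: s1 ++ e2 :: s2 ++ opp_end e1 :: s3 ++ opp_end e2 :: s4,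
      word D0 = s0 ++ s3 ++ s2 ++ s1 ++ s4
    & [set e1.1; e2.1] = [set x; y]].
Proof.
have [s0 [s1 [s2 [s3 [s4 [e1 [e2 [e3 [e4 [wD names wD0 _]]]]]]]]]] := smoothD.
have count_le1 e : (count_mem e (word D) <= 1)%N.
  by rewrite count_uniq_mem ?gauss_uniq // leq_b1.
have opp_eq (e e' : A * bool) : e.1 = e'.1 -> e != e' -> e' = opp_end e.
  by case: e e' => a b [a' b'] /= <-; rewrite /opp_end xpair_eqE eqxx; case: b b' => -[].
have [n13 n24 n12] : [/\ e1.1 = e3.1, e2.1 = e4.1 & [set e1.1; e2.1] = [set x; y]].
  move: names; rewrite inE mem_seq1.
  by case/orP => /eqP[-> -> -> ->]; split=> //; exact: setUC.
exists s0, s1, s2, s3, s4, e1, e2; split=> //.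
have <- : e3 = opp_end e1.
  apply: opp_eq => //; apply/eqP => eqe; have := count_le1 e1.
  by rewrite wD; do 5! rewrite /= ?count_cat; rewrite -eqe eqxx; lia.
have <- // : e4 = opp_end e2.
apply: opp_eq => //; apply/eqP => eqe; have := count_le1 e2.
by rewrite wD; do 5! rewrite /= ?count_cat; rewrite -eqe eqxx; lia.
Qed.

Lemma gauss_double_smoothing : gauss_diagram D0.
Proof.
have [s0 [s1 [s2 [s3 [s4 [e1 [e2 [wD wD0 _]]]]]]]] := double_smoothing_ends.
exact: gauss_diagram_smoothing wD wD0.
Qed.

Lemma crossings_double_smoothing : crossings D0 = crossings D :\: [set x; y].
Proof.
have [s0 [s1 [s2 [s3 [s4 [e1 [e2 [wD wD0 <-]]]]]]]] := double_smoothing_ends.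
exact: crossings_smoothing wD wD0.
Qed.

Lemma smoothed_crossings : [set x; y] \subset crossings D.
Proof.
have [s0 [s1 [s2 [s3 [s4 [e1 [e2 [wD _ <-]]]]]]]] := double_smoothing_ends.
rewrite subUset !sub1set !inE wD; apply/andP; split; apply: map_f;
  by do 3! rewrite ?mem_cat ?inE ?eqxx ?orbT //.
Qed.

(** Smoothing [x] and [y] commutes with passing to a subdiagram which contains
    them, so the comparison of journeys applies to subdiagrams. *)
Lemma subdiagram_smoothing (S : {set A}) : [set x; y] \subset S -> S \subset crossings D ->
  [/\ one_component (subdiagram D0 S) = one_component (subdiagram D S),
      {in S :\: [set x; y], ordered (subdiagram D0 S) =1 ordered (subdiagram D S)}
    & crossings (subdiagram D0 S) = S :\: [set x; y]].
Proof.
move=> xyS sS.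
have [s0 [s1 [s2 [s3 [s4 [e1 [e2 [wD wD0 e12]]]]]]]] := double_smoothing_ends.
move: xyS; rewrite -e12 subUset !sub1set => /andP[e1S e2S].
have gS := gauss_subdiagram S gD.
pose s i := [seq e <- nth [::] [:: s0; s1; s2; s3; s4] i | e.1 \in S].
have wS : word (subdiagram D S) = s 0%N ++ e1 :: s 1%N ++ e2 :: s 2%N ++ opp_end e1 :: s 3%N
     ++ opp_end e2 :: s 4%N.
  by rewrite /= wD !filter_cat /= e1S !filter_cat /= e2S !filter_cat /= e1S !filter_cat /= e2S.
have wS0 : word (subdiagram D0 S) = s 0%N ++ s 3%N ++ s 2%N ++ s 1%N ++ s 4%N.
  by rewrite /= wD0 !filter_cat.
have cS : crossings (subdiagram D0 S) = S :\: [set e1.1; e2.1].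
  by rewrite (crossings_smoothing gS wS wS0) crossings_subdiagram.
split=> // [|a aS]; first exact: one_component_smoothing gS wS wS0.
by rewrite (ordered_smoothing gS wS wS0) // cS.
Qed.

Hypothesis sgn_x : sgn D x = true.
Hypothesis sgn_y : sgn D y = true.

(** The left-hand side is what the alternating sum leaves of the subdiagram of [D]
    on [x], [y] and [T]. *)
Lemma ascending_weight_smoothing (T : {set A}) :
  T \subset crossings D0 ->
  let E := subdiagram D ([set x; y] :|: T) in
  (if one_component E && [forall a in T, ordered E a] then weight E else 0)
  = ascending_weight (subdiagram D0 T).
Proof.
rewrite crossings_double_smoothing => /[dup] TD0.
rewrite subsetD => /andP[TD dT] /=; rewrite disjoint_sym in dT.
set S := _ :|: T; have ST : S :\: [set x; y] = T.
  by rewrite setDUl setDv set0U; apply/setDidPl; rewrite disjoint_sym.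
have SD : S \subset crossings D by rewrite subUset smoothed_crossings.
have := subdiagram_smoothing (subsetUl _ T) SD; rewrite -/S ST => -[ocS ordS cS].
have -> : subdiagram D0 T = subdiagram D0 S.
  congr GaussCode; apply: eq_in_filter => e ew.
  rewrite in_setU; suff /negPf -> : e.1 \notin [set x; y] by [].
  have : e.1 \in crossings D0 by rewrite inE map_f.
  by rewrite crossings_double_smoothing => /setDP[].
have sgnD0 : {in crossings D0, sgn D0 =1 sgn D}.
  by have [? [? [? [? [? [? [? [? [? [_ _ _ +]]]]]]]]]] := smoothD.
rewrite /ascending_weight ascendingE cS -ocS.
have -> : weight (subdiagram D S) = weight (subdiagram D0 S).
  rewrite /weight cS crossings_subdiagram // (big_setID [set x; y]) /= ST.
  rewrite (setIidPr (subsetUl _ T)) big_setU1 ?inE //= big_set1.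
  rewrite sgn_x sgn_y !mul1r; apply: eq_bigr => a aT.
  by rewrite sgnD0 // crossings_double_smoothing (subsetP TD0).
congr (if _ && _ then _ else _).
by apply: eq_forallb_in => a aT; rewrite ordS.
Qed.

Hypothesis label_x : flabel None D x = None.
Hypothesis label_y : flabel None D y = None.
Hypothesis label_D0 : {in crossings D0, flabel None D0 =1 flabel None D}.

Lemma selected_smoothing m (T : {set A}) : T \subset crossings D0 ->
  selected m (flabel None D) ([set x; y] :|: T) = selected m (flabel None D0) T.
Proof.
move=> /subsetP TD0; have lT a : a \in T -> flabel None D a = flabel None D0 a.
  by move=> /TD0/label_D0.
rewrite /selected; congr orb.
  apply/forall_inP/forall_inP => allN a aT.
    by rewrite -lT // allN // inE aT orbT.
  by move: aT; rewrite !inE => /orP[/orP[] /eqP -> | aT]; rewrite ?label_x ?label_y // lT ?allN.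
case: m => // k; apply/exists_inP/exists_inP => [] [a aT la].
  move: aT la; rewrite !inE => /orP[/orP[] /eqP -> | aT]; rewrite ?label_x ?label_y //.
  by rewrite lT //; exists a.
by exists a; rewrite ?lT // inE aT orbT.
Qed.

(** Adding [x] and [y] is a bijection from the acceptable sets of arrows of [D0]
    onto those of [D] which contain [x] and [y]; it raises [n] by one. *)
Lemma conway_coef_relation m n :
  conway_coef n m D - conway_coef n m (crossing_change y D)
    - conway_coef n m (crossing_change x D)
    + conway_coef n m (crossing_change x (crossing_change y D))
  = if n is n'.+1 then conway_coef n' m D0 else 0.
Proof.
have gC a E := @gauss_crossing_change A a E.
pose P (S : {set A}) := [&& S \subset crossings D, #|S| == n.*2
                         & selected m (flabel None D) S].
have coefC E : gauss_diagram E -> crossings E = crossings D ->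
    flabel None E =1 flabel None D ->
  conway_coef n m E = \sum_(S | P S) ascending_weight (subdiagram E S).
  move=> gE cE lE; rewrite (conway_coefE x) //; apply: eq_bigl => S.
  rewrite cE /P /selected; congr [&& _, _ & _ || _].
    by apply: eq_forallb => a; rewrite lE.
  by case: (m) => // k; apply: eq_existsb => a; rewrite lE.
have lC a E : flabel None E =1 flabel None D ->
    flabel None (crossing_change a E) =1 flabel None D.
  by move=> lE b; rewrite flabel_crossing_change.
rewrite !coefC ?crossings_crossing_change //;
  do ?[exact: gC | exact/gC/gC | exact: lC | exact/lC/lC].
rewrite -!sumrB -big_split /=.
under eq_bigr => S _.
  rewrite !subdiagram_crossing_change alternating_sum ?gauss_subdiagram //.
  over.
(* A set containing [x] and [y] is not empty, so there is no constant term. *)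
rewrite /=; case: n @P coefC => [|n] P _.
  rewrite big1 // => S /and3P[_ /eqP/cards0_eq -> _].
  case: ifP => // /and3P[+ _ _]; rewrite crossings_subdiagram ?sub0set //.
  by rewrite subset0 -subset0 subUset sub1set inE.
pose B := [set x; y].
rewrite (conway_coefE x) ?gauss_double_smoothing //.
rewrite (bigID (fun S : {set A} => B \subset S)) /= [X in _ + X]big1 ?addr0; last first.
  move=> S /andP[/and3P[SD _ _] /negPf BS].
  by rewrite crossings_subdiagram // -/B BS.
rewrite (reindex_onto (fun T => B :|: T) (fun S => S :\: B)) /=; last first.
  move=> S /andP[_ BS]; rewrite setDE setUIr setUCr setIT; exact/setUidPr.
have BD : B \subset crossings D := smoothed_crossings.
apply: eq_big => [T|T /andP[/andP[/and3P[SD _ _] BS] /eqP TE]].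
  rewrite /P subsetUl andbT -andbA crossings_double_smoothing subUset BD /= subsetD.
  rewrite setDUl setDv set0U.
  have -> : (T :\: B == T) = [disjoint T & B] by apply/eqP/setDidPl.
  case: (boolP (T \subset crossings D)) => //= TD.
  case: (boolP [disjoint T & B]) => //= [dT|_]; last by rewrite !andbF.
  rewrite andbT selected_smoothing; last by rewrite crossings_double_smoothing subsetD TD.
  by rewrite cardsU disjoint_setI0 1?disjoint_sym // cards0 subn0 cards2 xy doubleS eqn_add2l.
rewrite crossings_subdiagram // BS TE /= -ascending_weight_smoothing //.
by rewrite crossings_double_smoothing -TE setSD.
Qed.

End ConwayRelation.

Theorem theorem12 (A : finType) (m : natinf) (x y : A)
    (Kpp Kpm Kmp Kmm K00 : gauss_code A)
    (quintuple : conway_quintuple x y Kpp Kpm Kmp Kmm K00)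
    (linked_xy : linked Kpp x y)
    (label_x : flabel None Kpp x = None)
    (label_y : flabel None Kpp y = None)
    (label_00 : {in crossings K00, forall a : A,
                   flabel None K00 a = flabel None Kpp a}) :
  nabla m Kpp - nabla m Kpm - nabla m Kmp + nabla m Kmm = 'X^2 * nabla m K00.
Proof.
case: quintuple => gD _ sx sy -> -> -> smoothD.
have xy : x != y by case/andP: linked_xy.
have rel := conway_coef_relation gD xy smoothD sx sy label_x label_y label_00 m.
apply/polyP => i; rewrite coefD !coefB coefXnM !coef_nabla.
case: i => [|[|i]] /=; rewrite ?subr0 ?addr0 ?rel //.
by rewrite negbK subn2 /=; case: ifP => _; rewrite ?rel ?subr0 ?addr0.
Qed.
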